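(* The operator $\gamma_A:(\mathcal{T},\|\cdot\|_{q.u.})\to L^0(\partial_MD;h^A_m)$ is continuous.
   Context: Let $d\ge 2$, let $m$ be Lebesgue measure on $\mathbb{R}^d$ and let $D\subset\mathbb{R}^d$ be an arbitrary bounded open set. Let $a=(a_{ij}):\mathbb{R}^d\to\mathbb{R}^d\otimes\mathbb{R}^d$ be a bounded measurable symmetric matrix-valued function such that for some $\lambda>0$, $\sum_{i,j}a_{ij}(x)\xi_i\xi_j\ge\lambda|\xi|^2$ for all $x,\xi\in\mathbb{R}^d$. Put $Au=\sum_{i,j=1}^d(a_{ij}u_{x_i})_{x_j}$. $\mathcal{B}(S)$ denotes the set of Borel functions on $S$. Process: $\mathbb{X}=(\{X_t\},\{P_x,x\in\mathbb{R}^d\},\{\mathcal{F}_t\})$ is the diffusion on $\mathbb{R}^d$ associated with $A$ (generator $A$, corresponding to the Dirichlet form $(a\nabla u,\nabla v)_{L^2(\mathbb{R}^d;m)}$ on $H^1(\mathbb{R}^d)$, defined for every starting point); $\tau_D=\inf\{t>0:X_t\in\mathbb{R}^d\setminus D\}$. Put $P_m=\int_DP_x\,m(dx)$ and let $E_m$ be the corresponding integral. Martin boundary: let $g_D$ be the Green function for $D$ and $A$, $\delta(y)=\int_Dg_D(y,z)\,m(dz)=E_y\tau_D$, $\kappa(x,y)=g_D(x,y)\delta^{-1}(y)$, $\hat\kappa f=\int_D\kappa(x,\cdot)f(x)\,m(dx)$, and let $\{f_n\}$ be a (countable) dense subset of $C_0(D)$. Define the metric $\varrho(x,y)=\sum_{n\ge1}2^{-n}\frac{|\hat\kappa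 f_n(x)-\hat\kappa f_n(y)|}{1+|\hat\kappa f_n(x)-\hat\kappa f_n(y)|}$ on $D$; $D^*$ is the completion of $D$ with respect to $\varrho$ and $\partial_MD=D^*\setminus D$ is the Martin boundary. For every $x\in D$, $P_x$-a.s. the limit $X_{\tau_D-}=\lim_{t\nearrow\tau_D}X_t$ exists with respect to $\varrho$ and belongs to $\partial_MD$. Put $h^A_x(dy)=P_x(X_{\tau_D-}\in dy)$, $h^A_m(dy)=\int_Dh^A_x(dy)\,m(dx)$, and $X^*_t=\mathbf{1}_{[0,\tau_D)}(t)X_t+\mathbf{1}_{\{t=\tau_D\}}X_{\tau_D-}$ for $t\in[0,\tau_D]$. $\mathcal{T}$ is the set of all $\psi\in\mathcal{B}(D)$ for which there exists $g\in\mathcal{B}(\partial_MD)$ such that the process $[0,\tau_D]\ni t\mapsto(\mathbf{1}_D\psi+\mathbf{1}_{\partial_MD}g)(X^*_t)$ is continuous at $\tau_D$ under $P_x$ for $m$-a.e. $x\in D$, i.e. $g(X_{\tau_D-})=\lim_{t\nearrow\tau_D}\psi(X_t)$ $P_x$-a.s. for $m$-a.e. $x\in D$; such $g$ is unique up to $h^A_m$-a.e. equality and one sets $\gamma_A(\psi):=g$. $\mathcal{T}$ is equipped with the metric induced by $\|u\|_{q.u.}=E_m\sup_{t<\tau_D}(|u(X_t)|\wedge1)$. $L^0(\partial_MD;h^A_m)$ is $\mathcal{B}(\partial_MD)$ equipped with the metric of convergence in measure $h^A_m$. *)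

(* Defs.v *)
From HB Require Import structures.
From mathcomp Require Import all_boot all_order all_algebra.
From mathcomp Require Import all_classical all_reals all_analysis.
From mathcomp Require Import measurable_realfun.

Set Implicit Arguments.
Unset Strict Implicit.
Unset Printing Implicit Defensive.

Import Order.TTheory GRing.Theory Num.Theory.
Import numFieldNormedType.Exports.

Local Open Scope classical_set_scope.
Local Open Scope ring_scope.

HB.instance Definition _ (R : realType) (d : nat) :=
  @isMeasurable.Build (sigma_display (@open 'rV[R]_d)) 'rV[R]_d
    <<s @open 'rV[R]_d >> (@sigma_algebra0 _ setT _) (@sigma_algebraC _ _)
    (@sigma_algebra_bigcup _ setT _).

Lemma open_borel (R : realType) (d : nat) (D : set 'rV[R]_d) :
  open D -> measurable D.
Proof. by move=> oD; exact: sub_sigma_algebra. Qed.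

Section euclidean.
Context {R : realType} {d : nat}.
Implicit Types (m : {measure set 'rV[R]_d -> \bar R}) (D : set 'rV[R]_d).
Implicit Types (a : 'rV[R]_d -> 'M[R]_d) (u v phi : 'rV[R]_d -> R).
Implicit Types (Du Dv : 'rV[R]_d -> 'rV[R]_d).

(* The volume of boxes determines a Borel measure, so this singles out the
   d-dimensional Lebesgue measure. *)
Definition is_lebesgue m : Prop :=
  forall x y : 'rV[R]_d, (forall i, x 0 i <= y 0 i) ->
    m [set z : 'rV[R]_d | forall i, x 0 i < z 0 i <= y 0 i] =
    (\prod_i (y 0 i - x 0 i))%:E.

Definition elliptic_coefficients (lambda : R) a : Prop :=
  [/\ forall i j, measurable_fun setT (fun x => a x i j),
      exists M : R, forall x i j, `|a x i j| <= M,
      forall x, (a x)^T = a x,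
      0 < lambda &
      forall x (xi : 'rV[R]_d),
        \sum_i \sum_j a x i j * xi 0 i * xi 0 j >= lambda * \sum_i xi 0 i ^+ 2].

Definition e_ (i : 'I_d) : 'rV[R]_d := delta_mx 0 i.

Fixpoint class_C (k : nat) phi : Prop :=
  continuous phi /\
  if k is k'.+1 then
    forall i, (forall x, derivable phi x (e_ i)) /\ class_C k' ('D_(e_ i) phi)
  else True.

Definition test_function phi : Prop :=
  (forall k, class_C k phi) /\ compact (closure [set x | phi x != 0]).

Definition in_H1 m u Du : Prop :=
  [/\ u \in Lfun m 2%:E,
      forall i, (fun x => Du x 0 i) \in Lfun m 2%:E &
      forall phi, test_function phi -> forall i,
        \int[m]_x (u x * 'D_(e_ i) phi x) = - \int[m]_x (Du x 0 i * phi x)].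

Definition dirichlet_form m a Du Dv : R :=
  \int[m]_x \sum_i \sum_j (a x i j * Du x 0 i * Dv x 0 j).

End euclidean.

Section process.
Context {R : realType} {d : nat} {dO : measure_display} {O : measurableType dO}.
Context (m : {measure set 'rV[R]_d -> \bar R}).
(* X is indexed by the real line but only its values at times t >= 0 are used. *)
Context (P : R.-pker 'rV[R]_d ~> O) (X : R -> O -> 'rV[R]_d).
Implicit Types (D : set 'rV[R]_d) (w : O).

Definition transition (t : R) (f : 'rV[R]_d -> R) (x : 'rV[R]_d) : R :=
  \int[P x]_w f (X t w).

Definition resolvent (alpha : R) (f : 'rV[R]_d -> R) (x : 'rV[R]_d) : R :=
  \int[lebesgue_measure]_(t in `[0, +oo[) (expR (- (alpha * t)) * transition t f x).

Definition filtration (F : R -> set (set O)) : Prop :=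
  [/\ forall t, 0 <= t -> sigma_algebra setT (F t),
      forall t, 0 <= t -> F t `<=` measurable &
      forall s t, 0 <= s -> s <= t -> F s `<=` F t].

Record continuous_markov_process (F : R -> set (set O)) : Prop := {
  cmp_filtration : filtration F ;
  cmp_adapted : forall t B, 0 <= t -> measurable B -> F t (X t @^-1` B) ;
  cmp_start : forall x, {ae P x, forall w, X 0 w = x} ;
  cmp_paths : forall x,
    {ae P x, forall w, {within `[0, +oo[, continuous (X ^~ w)}} ;
  cmp_markov : forall x s t A B, 0 <= s -> 0 <= t -> F s A -> measurable B ->
    P x (A `&` X (s + t) @^-1` B) =
    (\int[P x]_(w in A) P (X s w) (X t @^-1` B))%E }.

Definition strong_feller : Prop :=
  forall t (f : 'rV[R]_d -> R), 0 < t -> measurable_fun setT f ->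
    (exists M : R, forall x, `|f x| <= M) -> continuous (transition t f).

(* The alpha-resolvent of the process is that of the form (a grad u, grad v)
   with domain H^1. *)
Definition associated_with (a : 'rV[R]_d -> 'M[R]_d) : Prop :=
  forall alpha f, 0 < alpha -> f \in Lfun m 2%:E ->
    (exists M : R, forall x, `|f x| <= M) ->
    exists2 DG, in_H1 m (resolvent alpha f) DG &
      forall v Dv, in_H1 m v Dv ->
        dirichlet_form m a DG Dv + alpha * \int[m]_x (resolvent alpha f x * v x) =
        \int[m]_x (f x * v x).

(* The association fixes the law of the process for almost every starting point
   only; the strong Feller property fixes it for all of them. *)
Definition diffusion (a : 'rV[R]_d -> 'M[R]_d) (F : R -> set (set O)) : Prop :=
  [/\ continuous_markov_process F, strong_feller & associated_with a].

Definition exit_time D w : \bar R :=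
  ereal_inf [set t%:E | t in [set t : R | 0 < t /\ ~ D (X t w)]].

(* The filter of left neighbourhoods of tau, which may be infinite. *)
Definition before (tau : \bar R) : set_system R :=
  [set A | exists2 s : R, (s%:E < tau)%E &
    forall t : R, s < t -> (t%:E < tau)%E -> A t].

Section green.
Context (D : set 'rV[R]_d) (g : 'rV[R]_d -> 'rV[R]_d -> \bar R).
Local Open Scope ereal_scope.

(* g is the symmetric occupation density of the process killed on leaving D; it
   is determined at every pair of points by being excessive. *)
Record is_green : Prop := {
  green_measurable : measurable_fun (D `*` D)
    (fun z : 'rV[R]_d * 'rV[R]_d => g z.1 z.2) ;
  green_ge0 : forall x y, D x -> D y -> 0 <= g x y ;
  green_sym : forall x y, D x -> D y -> g x y = g y x ;
  green_occupation : forall x B, D x -> measurable B -> B `<=` D ->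
    \int[P x]_w lebesgue_measure
      [set t : R | [/\ (0 <= t)%R, t%:E < exit_time D w & B (X t w)]] =
    \int[m]_(y in B) g x y ;
  green_supermean : forall x y t, D x -> D y -> (0 <= t)%R ->
    \int[P x]_(w in [set w | t%:E < exit_time D w]) g (X t w) y <= g x y ;
  green_excessive : forall x y, D x -> D y ->
    \int[P x]_(w in [set w | t%:E < exit_time D w]) g (X t w) y
      @[t --> 0^'+] --> g x y }.

Definition mean_exit_time (y : 'rV[R]_d) : \bar R := \int[m]_(z in D) g y z.

Definition kappa (x y : 'rV[R]_d) : \bar R :=
  g x y * ((fine (mean_exit_time y))^-1)%:E.

Definition kappa_hat (f : 'rV[R]_d -> R) (y : 'rV[R]_d) : R :=
  fine (\int[m]_(x in D) (kappa x y * (f x)%:E)).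

(* The functions are numbered from 0 instead of 1. *)
Definition martin_dist (f : nat -> 'rV[R]_d -> R) (x y : 'rV[R]_d) : R :=
  fine (\sum_(0 <= n <oo)
    (2^-1 ^+ n.+1 * (`|kappa_hat (f n) x - kappa_hat (f n) y| /
      (1 + `|kappa_hat (f n) x - kappa_hat (f n) y|)))%R%:E).

End green.

(* Functions of C_0(D) are extended by 0 to the whole space. *)
Definition C0 D (h : 'rV[R]_d -> R) : Prop :=
  continuous h /\ forall x, ~ D x -> h x = 0.

Definition dense_in_C0 D (f : nat -> 'rV[R]_d -> R) : Prop :=
  (forall n, C0 D (f n)) /\
  forall h, C0 D h -> forall e, 0 < e -> exists n, forall x, `|f n x - h x| < e.

End process.

Definition is_completion {R : realType} {T : Type} (D : set T) (rho : T -> T -> R)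
    (M : metricType R) (iota : T -> M) : Prop :=
  [/\ forall G : set_system M, ProperFilter G -> cauchy G ->
        exists l : M, G --> l,
      forall x y, D x -> D y -> mdist (iota x) (iota y) = rho x y &
      closure (iota @` D) = setT].

(* The complement of D in its completion, as a subspace. Measurable types have a
   base point in the library: b0 is a mere witness that the boundary is not
   empty. *)
Definition martin_boundary {R : realType} {T : Type} {D : set T}
  {M : metricType R} {iota : T -> M} (b0 : ~` (iota @` D)) : Type :=
  set_type (~` (iota @` D)).

Section boundary_instances.
Context {R : realType} {T : Type} {D : set T} {M : metricType R} {iota : T -> M}.
Context (b0 : ~` (iota @` D)).

HB.instance Definition _ :=
  Topological.copy (martin_boundary b0) (set_type (~` (iota @` D))).
HB.instance Definition _ := isPointed.Build (martin_boundary b0) b0.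
HB.instance Definition _ :=
  @isMeasurable.Build (sigma_display (@open (martin_boundary b0)))
    (martin_boundary b0) <<s @open (martin_boundary b0) >>
    (@sigma_algebra0 _ setT _) (@sigma_algebraC _ _)
    (@sigma_algebra_bigcup _ setT _).

End boundary_instances.

Section mixture.
Local Open Scope ereal_scope.
Context {R : realType} {d1 d2 : measure_display}.
Context {S : measurableType d1} {T : measurableType d2}.
Context (m : {measure set S -> \bar R}) (D : set S) (mD : measurable D).
Context (k : R.-ker S ~> T).

(* The measurability of D is an argument for the sake of the measure instance. *)
Definition mixture (_ : measurable D) (B : set T) : \bar R :=
  \int[m]_(x in D) k x B.

Let mixture0 : mixture mD set0 = 0.
Proof.
by rewrite /mixture (eq_integral (cst 0)) ?integral0// => y _; rewrite measure0.
Qed.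

Let mixture_ge0 B : 0 <= mixture mD B.
Proof. by apply: integral_ge0. Qed.

Let mixture_sigma_additive : semi_sigma_additive (mixture mD).
Proof.
move=> U mU tU mUU; rewrite [X in _ --> X](_ : _ =
  \int[m]_(x in D) (\sum_(n <oo) k x (U n))); last first.
  apply: eq_integral => V _.
  by apply/esym/cvg_lim => //; exact/measure_semi_sigma_additive.
apply/cvg_closeP; split.
  by apply: is_cvg_nneseries => n _ _; exact: integral_ge0.
rewrite closeE// integral_nneseries// => n.
exact/measurable_funTS/measurable_kernel.
Qed.

HB.instance Definition _ :=
  isMeasure.Build _ _ _ (mixture mD) mixture0 mixture_ge0 mixture_sigma_additive.

End mixture.

Section exit_law.
Context {R : realType} {d1 d2 d3 : measure_display}.
Context {S : measurableType d1} {O : measurableType d2} {T : measurableType d3}.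
Context (P : R.-ker S ~> O) (Y : {mfun O >-> T}).

Definition exit_law_at (x : S) : set T -> \bar R := pushforward (P x) Y.

Let exit_law0 x : exit_law_at x set0 = 0%E.
Proof. by rewrite /exit_law_at /pushforward preimage_set0 measure0. Qed.

Let exit_law_ge0 x B : (0 <= exit_law_at x B)%E.
Proof. exact: measure_ge0. Qed.

Let exit_law_sigma_additive x : semi_sigma_additive (exit_law_at x).
Proof.
pose mu : {measure set T -> \bar R} :=
  measure_function_pushforward__canonical__measure_function_Measure
    (P x) (measurable_funPT Y).
exact: (@measure_semi_sigma_additive _ _ _ mu).
Qed.

HB.instance Definition _ x := isMeasure.Build _ _ _ (exit_law_at x)
  (exit_law0 x) (exit_law_ge0 x) (@exit_law_sigma_additive x).

Definition exit_law (x : S) : {measure set T -> \bar R} := exit_law_at x.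

Let measurable_exit_law U :
  measurable U -> measurable_fun [set: S] (exit_law ^~ U).
Proof.
move=> mU; apply: (measurable_kernel P (Y @^-1` U)).
by rewrite -[X in measurable X]setTI; exact: measurable_funPT.
Qed.

HB.instance Definition _ := isKernel.Build _ _ _ _ R exit_law measurable_exit_law.

End exit_law.

Section trace.
Context {R : realType} {d : nat} {dO : measure_display} {O : measurableType dO}.
Context (m : {measure set 'rV[R]_d -> \bar R}) (P : R.-pker 'rV[R]_d ~> O).
Context (X : R -> O -> 'rV[R]_d) (D : set 'rV[R]_d) (mD : measurable D).
Implicit Types (u v psi : 'rV[R]_d -> R).
Local Open Scope ereal_scope.

(* The integral with respect to the measure int_D P_x m(dx). *)
Definition expectation_m (f : O -> \bar R) : \bar R :=
  \int[m]_(x in D) \int[P x]_w f w.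

(* The supremum is taken among nonnegative numbers: it is 0 over the empty set.
   Library integrals of nonnegative functions are suprema of integrals of simple
   functions, hence agree with those for the completed measures. *)
Definition qu_norm u : \bar R :=
  expectation_m (fun w => ereal_sup (0 |` [set (Num.min `|u (X t w)| 1)%:E |
    t in [set t : R | (0 <= t)%R /\ t%:E < exit_time X D w]])).

Definition qu_dist u v : \bar R := qu_norm (u \- v)%R.

Context {M : metricType R} {iota : 'rV[R]_d -> M} {b0 : ~` (iota @` D)}.
Context (Y : {mfun O >-> martin_boundary b0}).
Implicit Types g : martin_boundary b0 -> R.

Definition is_martin_limit : Prop :=
  forall x, D x -> {ae P x, forall w,
    iota (X t w) @[t --> before (exit_time X D w)] --> (set_val (Y w) : M)}.

Definition harmonic_measure : {measure set (martin_boundary b0) -> \bar R} :=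
  mixture m (exit_law P Y) mD.

Definition is_trace psi g : Prop :=
  measurable_fun setT g /\
  {ae m, forall x, D x -> {ae P x, forall w,
    psi (X t w) @[t --> before (exit_time X D w)] --> g (Y w)}}.

(* Only the values on D of an element of the class matter. *)
Definition trace_class : set ('rV[R]_d -> R) :=
  [set psi | measurable_fun D psi /\ exists g, is_trace psi g].

(* Traces being unique up to null sets only, the trace operator is any choice of
   representatives. *)
Definition trace_operator
    (gamma : ('rV[R]_d -> R) -> martin_boundary b0 -> R) : Prop :=
  forall psi, trace_class psi -> is_trace psi (gamma psi).

(* A metric of convergence in measure. *)
Definition L0_dist g1 g2 : \bar R :=
  \int[harmonic_measure]_y (Num.min `|g1 y - g2 y| 1)%:E.

End trace.

Definition metric_continuous {R : realType} {U V : Type} (S : set U)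
    (dU : U -> U -> \bar R) (dV : V -> V -> \bar R) (F : U -> V) : Prop :=
  forall u, S u -> forall e : R, 0 < e ->
    exists2 delta : R, 0 < delta &
      forall v, S v -> (dU v u < delta%:E)%E -> (dV (F v) (F u) < e%:E)%E.

(* Main.v *)
Require Import Defs.
From mathcomp Require Import all_boot all_order all_algebra.
From mathcomp Require Import all_classical all_reals all_analysis.
From mathcomp Require Import measurable_realfun.

Import Order.TTheory GRing.Theory Num.Theory.
Import numFieldNormedType.Exports.

Local Open Scope classical_set_scope.
Local Open Scope ring_scope.

(** The trace operator does not increase distances: for [u], [v] in the trace
    class, [L0_dist (gamma v) (gamma u) <= qu_dist v u], so that [delta = e]
    works in the definition of continuity.

    For almost every [x] in [D] and almost surely under [P x], the value
    [gamma u (Y w)] is the limit of [u (X t w)] as [t] increases to the exit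
    time, and likewise for [v]. Hence [|gamma v (Y w) - gamma u (Y w)|], cut at
    [1], is the limit of [|v (X t w) - u (X t w)|], cut at [1], and is at most
    the supremum of the latter over the times before the exit
    ([limit_before_le_sup]). This presupposes that there are nonnegative times
    before the exit, which holds almost surely since paths are continuous and
    start in the open set [D] ([exit_time_gt0]). Integrating the inequality with
    respect to [P x] and then over [D], and recognizing the left-hand side as an
    integral against the harmonic measure, which is the law of [Y] under
    the mixture of the [P x] ([ge0_integral_mixture_le]), gives the claim.

    The supremum over an uncountable set of times is not known to be a
    measurable function of [w], nor its expectation one of [x]; the comparisons
    of integrals therefore allow an arbitrary nonnegative majorant
    ([ae_ge0_le_integral_majorant]). *)

(** * Comparison of integrals *)

(** The integral of a nonnegative function is a supremum over the simple
    functions below it, hence monotone for arbitrary functions. The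
    measurability of [f1] serves to discard the null set where the inequality
    fails. *)
Lemma ae_ge0_le_integral_majorant (d : measure_display) (T : measurableType d)
    (R : realType) (mu : {measure set T -> \bar R}) (D : set T)
    (f1 f2 : T -> \bar R) :
  measurable D -> measurable_fun D f1 ->
  (forall x, D x -> 0 <= f1 x)%E -> (forall x, D x -> 0 <= f2 x)%E ->
  {ae mu, forall x, D x -> (f1 x <= f2 x)%E} ->
  (\int[mu]_(x in D) f1 x <= \int[mu]_(x in D) f2 x)%E.
Proof.
move=> mD mf1 f10 f20 [N [mN muN0 f12N]].
rewrite (ge0_negligible_integral _ _ _ _ muN0)//.
rewrite (integral_mkcond (D `\` N)) (integral_mkcond D).
rewrite !ge0_integralTE; last 2 first.
- exact: erestrict_ge0.
- by apply: erestrict_ge0 => x [/f10].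
apply: ereal_sup_le => _ [h hf1 <-]; exists h => // x.
apply: le_trans (hf1 x) _; rewrite !patchE.
case: ifPn => [/set_mem[Dx Nx]|_].
  rewrite (mem_set Dx); apply: contrapT => f12; apply: Nx; apply: f12N.
  by move=> /(_ Dx).
by case: ifPn => // /set_mem /f20.
Qed.

Section integral_mixture.
Local Open Scope ereal_scope.
Context {R : realType} {d1 d2 : measure_display}.
Context {S : measurableType d1} {T : measurableType d2}.
Context (m : {measure set S -> \bar R}) (D : set S) (mD : measurable D).
Context (k : R.-ker S ~> T).

Import HBNNSimple.

Lemma sintegral_mixture (h : {nnsfun T >-> R}) :
  sintegral (mixture m k mD) h = \int[m]_(x in D) sintegral (k x) h.
Proof.
rewrite sintegralE; under [RHS]eq_integral do rewrite sintegralE.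
have mk r : measurable_fun D (fun x => k x (h @^-1` [set r])).
  exact/measurable_funTS/measurable_kernel.
rewrite ge0_integral_fsum//; last 2 first.
- by move=> r; apply: measurable_funeM.
- by move=> r x _; exact: nnsfun_mulemu_ge0.
apply: eq_fsbigr => r /set_mem[t _ <-].
by rewrite ge0_integralZl// lee_fin.
Qed.

(** A simple function below [g] has the same integral on both sides, by
    linearity; the supremum over these functions is taken outside the integral
    over [D] on the left and inside it on the right. *)
Lemma ge0_integral_mixture_le (g : T -> \bar R) : (forall y, 0 <= g y) ->
  \int[mixture m k mD]_y g y <= \int[m]_(x in D) \int[k x]_y g y.
Proof.
move=> g0; rewrite ge0_integralTE//.
apply: ge_ereal_sup => _ [h hg <-]; rewrite sintegral_mixture.
apply: ae_ge0_le_integral_majorant => //.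
- under eq_fun do rewrite -integralT_nnsfun.
  apply/measurable_funTS/measurable_fun_integral_kernel => //.
  + by move=> U mU; exact: measurable_kernel.
  + by move=> y; rewrite lee_fin.
  + exact/measurable_EFinP.
- by move=> x _; exact: sintegral_ge0.
- by move=> x _; exact: integral_ge0.
- apply: aeW => x _.
  by rewrite [leRHS]ge0_integralTE//; apply: ereal_sup_ubound; exists h.
Qed.

End integral_mixture.

Lemma ge0_integral_exit_law (R : realType) (d1 d2 d3 : measure_display)
    (S : measurableType d1) (O : measurableType d2) (T : measurableType d3)
    (P : R.-ker S ~> O) (Y : {mfun O >-> T}) (x : S) (g : T -> \bar R) :
  measurable_fun setT g -> (forall y, 0 <= g y)%E ->
  (\int[exit_law P Y x]_y g y = \int[P x]_w g (Y w))%E.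
Proof.
move=> mg g0.
by rewrite (ge0_integral_pushforward (measurable_funPT Y) (P x)).
Qed.

(** * Times before the exit *)

Lemma before_proper (R : realType) (tau : \bar R) :
  (0 < tau)%E -> ProperFilter (before tau).
Proof.
move=> tau0; apply: Build_ProperFilter_ex.
  move=> A [s stau As].
  have [t st ttau] : exists2 t : R, s < t & (t%:E < tau)%E.
    case: tau stau {tau0 As} => [r| |]//=; last first.
      by exists (s + 1); rewrite ?ltrDl ?ltry.
    by rewrite lte_fin => sr; exists ((s + r) / 2);
      rewrite ?lte_fin (midf_lt sr).
  by exists t; exact: As.
split.
- by exists 0.
- move=> A B [s stau As] [t ttau Bt]; exists (Num.max s t).
    by have [] := leP s t.
  by move=> r; rewrite gt_max => /andP[sr tr] rtau; split; [exact: As|exact: Bt].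
- by move=> A B AB [s stau As]; exists s => // t st ttau; exact/AB/As.
Qed.

Lemma limit_before_le_sup (R : realType) (tau : \bar R) (p : R -> R) (l : R) :
  (0 < tau)%E -> p t @[t --> before tau] --> l ->
  ((Num.min `|l| 1)%:E <= ereal_sup (0 |` [set (Num.min `|p t| 1)%:E |
     t in [set t : R | (0 <= t)%R /\ (t%:E < tau)%E]]))%E.
Proof.
move=> tau0 pl; set s := ereal_sup _.
have s0 : (0 <= s)%E by apply: ereal_sup_ubound; left.
have s1 : (s <= 1)%E.
  apply: ge_ereal_sup => _ [->|[t _ <-]]; first exact: lee01.
  by rewrite lee_fin ge_min lexx orbT.
have sfin : s \is a fin_num by rewrite ge0_fin_numE// (le_lt_trans s1)// ltry.
rewrite -(fineK sfin) lee_fin.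
have Ftau := before_proper _ _ tau0.
have cmin : {for l, continuous (fun r : R => Num.min `|r| 1)}.
  apply: (@continuous_min _ _ (fun r : R => `|r|) (cst 1)).
    exact: norm_continuous.
  exact: cst_continuous.
have pml : Num.min `|p t| 1 @[t --> before tau] --> Num.min `|l| 1.
  exact: (cvg_comp p (fun r : R => Num.min `|r| 1) pl cmin).
apply: (closed_cvg (fun r : R => r <= fine s) _ _ _ pml).
  exact: closed_le.
(* A left neighbourhood of [tau] may reach below [0], where the supremum does
   not look; the one above [0] avoids this. *)
exists 0 => // t t0 ttau; rewrite -lee_fin fineK//.
by apply: ereal_sup_ubound; right; exists t => //; split => //; exact: ltW.
Qed.

Lemma exit_time_gt0 (R : realType) (d : nat) (dO : measure_display)
    (O : measurableType dO) (X : R -> O -> 'rV[R]_d) (D : set 'rV[R]_d) (w : O) :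
  open D -> D (X 0 w) -> {within `[0, +oo[, continuous (X ^~ w)} ->
  (0 < exit_time X D w)%E.
Proof.
move=> oD DX0 /subspace_continuousP/(_ 0) cX.
have /cX/(_ D) : [set` `[0, +oo[%R] (0 : R) by rewrite /= in_itv/= lexx.
have /[swap]/[apply] : nbhs (X 0 w) D by exact: open_nbhs_nbhs.
move=> /nbhs_ballP[e /= e0 eD].
apply: (@lt_le_trans _ _ e%:E); first by rewrite lte_fin.
apply: le_ereal_inf_tmp => _ [t [t0 Dt] <-].
rewrite lee_fin leNgt; apply/negP => te; apply: Dt; apply: (eD t) => /=.
  by rewrite /ball/= sub0r normrN gtr0_norm.
by rewrite in_itv/= andbT ltW.
Qed.

(** * The trace operator is a contraction *)

Lemma L0_dist_le_qu_dist (R : realType) (d : nat)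
    (m : {measure set 'rV[R]_d -> \bar R}) (D : set 'rV[R]_d)
    (dO : measure_display) (O : measurableType dO)
    (P : R.-pker 'rV[R]_d ~> O) (X : R -> O -> 'rV[R]_d)
    (F : R -> set (set O))
    (M : metricType R) (iota : 'rV[R]_d -> M)
    (b0 : ~` (iota @` D)) (Y : {mfun O >-> martin_boundary b0})
    (D_open : open D) (u v : 'rV[R]_d -> R) (gu gv : martin_boundary b0 -> R) :
  continuous_markov_process P X F ->
  is_trace m P X Y u gu -> is_trace m P X Y v gv ->
  (L0_dist m P (open_borel D_open) Y gv gu <= qu_dist m P X D v u)%E.
Proof.
move=> XP [mgu tu] [mgv tv].
have g0 y : (0 <= (Num.min `|gv y - gu y| 1)%:E)%E.
  by rewrite lee_fin le_min normr_ge0/=.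
have mg : measurable_fun setT (fun y => (Num.min `|gv y - gu y| 1)%:E).
  apply/measurable_EFinP; apply: measurable_minr => //.
  by apply: measurableT_comp => //; exact: measurable_funB.
have sup0 w : (0 <= ereal_sup (0 |` [set (Num.min `|(v \- u) (X t w)| 1)%:E |
    t in [set t : R | (0 <= t)%R /\ (t%:E < exit_time X D w)%E]]))%E.
  by apply: ereal_sup_ubound; left.
apply: le_trans (ge0_integral_mixture_le _ _ _ _ _ g0) _.
apply: ae_ge0_le_integral_majorant.
- exact: open_borel.
- apply/measurable_funTS/measurable_fun_integral_kernel => // U mU.
  exact: measurable_kernel.
- by move=> x _; exact: integral_ge0.
- by move=> x _; exact: integral_ge0.
apply: filterS2 tu tv => x tu tv Dx.
rewrite ge0_integral_exit_law//.
apply: ae_ge0_le_integral_majorant => //.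
  exact: (measurableT_comp mg).
have start := cmp_start XP x; have paths := cmp_paths XP x.
have {}tu := tu Dx; have {}tv := tv Dx.
near=> w => _.
have X0 : X 0 w = x by near: w.
have tau0 : (0 < exit_time X D w)%E.
  by apply: exit_time_gt0 => //; [rewrite X0|near: w].
have Ftau := before_proper _ _ tau0.
apply: (limit_before_le_sup _ _ (fun t => (v \- u) (X t w))) => //.
by apply: cvgB; near: w.
Unshelve. all: by end_near. Qed.

Theorem proposition7p1 (R : realType) (d : nat)
    (m : {measure set 'rV[R]_d -> \bar R}) (D : set 'rV[R]_d)
    (a : 'rV[R]_d -> 'M[R]_d) (lambda : R)
    (dO : measure_display) (O : measurableType dO)
    (P : R.-pker 'rV[R]_d ~> O) (X : R -> O -> 'rV[R]_d)
    (F : R -> set (set O))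
    (gD : 'rV[R]_d -> 'rV[R]_d -> \bar R) (f : nat -> 'rV[R]_d -> R)
    (Dstar : metricType R) (iota : 'rV[R]_d -> Dstar)
    (b0 : ~` (iota @` D)) (Y : {mfun O >-> martin_boundary b0})
    (gamma : ('rV[R]_d -> R) -> martin_boundary b0 -> R)
    (d_ge2 : (2 <= d)%N)
    (m_lebesgue : is_lebesgue m)
    (D_open : open D)
    (D_bounded : bounded_set D)
    (a_elliptic : elliptic_coefficients lambda a)
    (X_diffusion : diffusion m P X a F)
    (gD_green : is_green m P X D gD)
    (f_dense : dense_in_C0 D f)
    (Dstar_completion : is_completion D (martin_dist m D gD f) iota)
    (Y_limit : is_martin_limit P X Y)
    (gamma_trace : trace_operator m P X Y gamma) :
  metric_continuous (trace_class m P X Y) (qu_dist m P X D)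
    (L0_dist m P (open_borel D_open) Y) gamma.
Proof.
have [XP _ _] := X_diffusion.
move=> u Tu e e0; exists e => // v Tv.
apply: le_lt_trans; apply: L0_dist_le_qu_dist XP _ _; exact: gamma_trace.
Qed.
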